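(* For every real number $p\neq 0$, the operation $C(H_p)$ is scale invariant; in other words, for all complex numbers $a,x_0,x_1,a_0,a_1$ for which the projections are defined, $$C\big(H_p((a_0\,a\,x_0,a_0),(a_1\,a\,x_1,a_1))\big)=a\,C\big(H_p((a_0x_0,a_0),(a_1x_1,a_1))\big).$$
   Context: For $p\in\mathbb{R}\setminus\{0\}$ the Hölder-Minkowski operation on pairs of complex numbers is $H_p((y_0,b_0),(y_1,b_1))=\big((y_0^p+y_1^p)^{1/p},\,(b_0^p+b_1^p)^{1/p}\big)$. The projection operator is $C((ax,a))=(x,1)$ for $a\neq 0$, identified with the number $x$. Thus $C(H_p((a_0x_0,a_0),(a_1x_1,a_1)))=\left(\frac{a_0^px_0^p+a_1^px_1^p}{a_0^p+a_1^p}\right)^{1/p}$, defined when $a_0^p+a_1^p\neq 0$. Convention on powers: complex numbers are kept in a general polar form $re^{i\theta}$, with the real argument $\theta$ not reduced modulo $2\pi$, and powers are taken as $(re^{i\theta})^p=r^pe^{ip\theta}$, with arguments adding under multiplication. Hence $(z^p)^{1/p}=z$, $(zw)^p=z^pw^p$ and $(zw)^{1/p}=z^{1/p}w^{1/p}$ always hold (including when a factor is a sum). For $z=0$, $0^p=0^{1/p}=0$. *)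

(* Defs.v *)
From Stdlib Require Import Reals Lra ProofIrrelevance ClassicalChoice.
From Coquelicot Require Import Coquelicot.
Open Scope R_scope.

(* [Polar r t] is r e^{it}.  The argument t is any real and is not reduced
   modulo 2 pi: [Polar r t] and [Polar r (t + 2 * PI)] are different elements,
   and their powers may represent different complex numbers. *)
Inductive polar : Type :=
| P0 : polar
| Polar (r : posreal) (t : R) : polar.

Declare Scope polar_scope.
Delimit Scope polar_scope with polar.
Bind Scope polar_scope with polar.

Definition pval (z : polar) : C :=
  match z with
  | P0 => RtoC 0
  | Polar r t => (r * cos t, r * sin t)
  end.

Definition pone : polar := Polar (mkposreal 1 Rlt_0_1) 0.

Definition pmul (z w : polar) : polar :=
  match z, w with
  | Polar r t, Polar s u =>
      Polar (mkposreal (r * s) (Rmult_lt_0_compat r s (cond_pos r) (cond_pos s)))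
            (t + u)
  | _, _ => P0
  end.

Definition pinv (z : polar) : polar :=
  match z with
  | P0 => P0
  | Polar r t => Polar (mkposreal (/ r) (Rinv_0_lt_compat r (cond_pos r))) (- t)
  end.

Definition pdiv (z w : polar) : polar := pmul z (pinv w).

Definition ppow (z : polar) (p : R) : polar :=
  match z with
  | P0 => P0
  | Polar r t => Polar (mkposreal (Rpower r p) (exp_pos (p * ln r))) (p * t)
  end.

Notation "z * w" := (pmul z w) : polar_scope.
Notation "z / w" := (pdiv z w) : polar_scope.
Notation "z ^ p" := (ppow z p%R) : polar_scope.

(* A choice, for every u, of one of the polar forms of the number 1 + u. *)
Definition one_plus_form (br : polar -> polar) : Prop :=
  forall u, pval (br u) = Cplus (RtoC 1) (pval u).

(* The complex sum of two polar forms has no preferred argument.  The rule that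
   arguments add under multiplication even when a factor is a sum forces
   z + w = z (1 + w / z), so that only the polar forms of the sums 1 + u are
   left to be chosen; [br] is that choice. *)
Definition psum (br : polar -> polar) (z w : polar) : polar :=
  match z with
  | P0 => w
  | Polar _ _ => (z * br (w / z))%polar
  end.

Definition Hp (br : polar -> polar) (p : R) (u0 u1 : polar * polar)
  : polar * polar :=
  ((psum br (fst u0 ^ p) (fst u1 ^ p) ^ (1 / p))%polar,
   (psum br (snd u0 ^ p) (snd u1 ^ p) ^ (1 / p))%polar).

(* C((a x, a)) = (x, 1), identified with x; meaningful only if [snd u <> P0]. *)
Definition proj (u : polar * polar) : polar := (fst u / snd u)%polar.

(* [psum_val], [one_plus_form_exists] and [psum_complete]: [psum br] represents
   the complex sum, a choice [br] exists, and no addition of polar forms (with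
   0 + w = w) over which multiplication distributes is left out. *)

Lemma Polar_eq (r s : posreal) (t u : R) :
  pos r = pos s -> t = u -> Polar r t = Polar s u.
Proof.
destruct r as [r hr], s as [s hs]; simpl; intros -> ->.
now rewrite (proof_irrelevance _ hr hs).
Qed.

Lemma pval_mul (z w : polar) : pval (z * w) = Cmult (pval z) (pval w).
Proof.
destruct z as [|r t], w as [|s u]; simpl; try (now rewrite ?Cmult_0_l, ?Cmult_0_r).
unfold Cmult; simpl; rewrite cos_plus, sin_plus; f_equal; ring.
Qed.

Lemma pmul_div (z w : polar) : z <> P0 -> (z * (w / z))%polar = w.
Proof.
destruct z as [|r t], w as [|s u]; intros hz; try easy.
unfold pdiv; simpl; apply Polar_eq; simpl.
- field; apply Rgt_not_eq, cond_pos.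
- ring.
Qed.

Lemma pmul_1_r (z : polar) : (z * pone)%polar = z.
Proof. destruct z as [|r t]; simpl; [easy|]; apply Polar_eq; simpl; ring. Qed.

Lemma psum_val (br : polar -> polar) (z w : polar) :
  one_plus_form br -> pval (psum br z w) = Cplus (pval z) (pval w).
Proof.
intros hbr; destruct z as [|r t]; unfold psum.
- now simpl pval at 2; rewrite Cplus_0_l.
- rewrite pval_mul, hbr, Cmult_plus_distr_l, Cmult_1_r, <- pval_mul.
  now rewrite pmul_div.
Qed.

Lemma pval_surj (c : C) : exists z, pval z = c.
Proof.
destruct (Ceq_dec c (RtoC 0)) as [->|hc]; [now exists P0|].
assert (hr : 0 < Cmod c) by now apply Cmod_gt_0.
destruct c as [x y].
set (r := Cmod (x, y)) in *.
assert (hsq : r * r = x * x + y * y).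
{ unfold r, Cmod; simpl; rewrite sqrt_sqrt; [ring|nra]. }
assert (hx : -1 <= x / r <= 1).
{ split; [apply Rle_div_r|apply Rle_div_l]; nra. }
assert (hcos : r * cos (acos (x / r)) = x).
{ rewrite cos_acos by easy; field; lra. }
assert (hsin : r * sin (acos (x / r)) = Rabs y).
{ rewrite sin_acos by easy.
  rewrite <- (sqrt_Rsqr r) at 1 by lra.
  rewrite <- sqrt_mult_alt by apply Rle_0_sqr.
  rewrite <- sqrt_Rsqr_abs; f_equal; unfold Rsqr.
  replace (r * r * (1 - x / r * (x / r))) with (r * r - x * x) by (field; lra).
  lra. }
destruct (Rle_dec 0 y) as [hy|hy].
- exists (Polar (mkposreal r hr) (acos (x / r))); simpl.
  now rewrite hcos, hsin, Rabs_pos_eq.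
- exists (Polar (mkposreal r hr) (- acos (x / r))); simpl.
  rewrite cos_neg, sin_neg, hcos, Ropp_mult_distr_r_reverse, hsin.
  rewrite Rabs_left by lra; now rewrite Ropp_involutive.
Qed.

Lemma one_plus_form_exists : exists br, one_plus_form br.
Proof.
apply (ClassicalChoice.choice (fun u z => pval z = Cplus (RtoC 1) (pval u))).
intros u; apply pval_surj.
Qed.

Lemma psum_complete (add : polar -> polar -> polar) :
  (forall z w, pval (add z w) = Cplus (pval z) (pval w)) ->
  (forall a z w, (a * add z w)%polar = add (a * z)%polar (a * w)%polar) ->
  (forall w, add P0 w = w) ->
  one_plus_form (add pone) /\ forall z w, add z w = psum (add pone) z w.
Proof.
intros hval hmul h0; split.
- intros u; rewrite hval; f_equal; unfold pone; simpl.
  rewrite cos_0, sin_0; unfold RtoC; f_equal; ring.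
- intros [|r t] w; [now rewrite h0|]; unfold psum.
  now rewrite hmul, pmul_1_r, pmul_div.
Qed.

(* Main.v *)
Require Import Defs.
From Stdlib Require Import Reals.
From Coquelicot Require Import Coquelicot.
Open Scope R_scope.

(** Polar forms with unreduced argument are a group with a zero adjoined, on
    which every real power is multiplicative and [z => z ^ (1/p)] undoes
    [z => z ^ p]; a common factor [a] of the two numerators thus becomes a
    common factor [a ^ p] of the two summands.  Since [psum br z w] is the
    product of [z] with a form depending only on the quotient [w / z], it is
    homogeneous ([pmul_psum]): [a ^ p] leaves the sum, and the power [1 / p]
    turns it back into [a] ([ppow_inv]).
    The denominators do not involve [a]. *)

Lemma pmul_comm (z w : polar) : (z * w)%polar = (w * z)%polar.
Proof.
destruct z as [|r t], w as [|s u]; try easy.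
apply Polar_eq; simpl; ring.
Qed.

Lemma pmul_assoc (x y z : polar) : (x * (y * z))%polar = (x * y * z)%polar.
Proof.
destruct x as [|r t], y as [|s u], z as [|q v]; try easy.
apply Polar_eq; simpl; ring.
Qed.

Lemma ppow_mul (z w : polar) (p : R) :
  ((z * w) ^ p)%polar = (z ^ p * w ^ p)%polar.
Proof.
destruct z as [|r t], w as [|s u]; try easy.
apply Polar_eq; simpl.
- symmetry; apply Rpower_mult_distr; apply cond_pos.
- ring.
Qed.

(** The argument is a real number, multiplied by [p] and then by [1 / p]:
    no multiple of [2 * PI] is lost, as it would be for complex powers. *)
Lemma ppow_inv (z : polar) (p : R) : p <> 0 -> ((z ^ p) ^ (1 / p))%polar = z.
Proof.
intros hp; destruct z as [|r t]; [easy|].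
apply Polar_eq; simpl.
- rewrite Rpower_mult; replace (p * (1 / p)) with 1 by (field; easy).
  apply Rpower_1, cond_pos.
- field; easy.
Qed.

Lemma pdiv_pmul_cancel (a z w : polar) :
  a <> P0 -> ((a * w) / (a * z))%polar = (w / z)%polar.
Proof.
destruct a as [|r t], z as [|s u], w as [|q v]; intros ha; try easy.
apply Polar_eq; simpl.
- field; split; apply Rgt_not_eq, cond_pos.
- ring.
Qed.

(** The form of [1 + u] is taken at [u = w / z], which a common nonzero factor
    does not change; for [a = P0] both sides are [P0]. *)
Lemma pmul_psum (br : polar -> polar) (a z w : polar) :
  psum br (a * z) (a * w) = (a * psum br z w)%polar.
Proof.
destruct a as [|r t]; [easy|].
destruct z as [|s u]; [easy|].
change (Polar r t * Polar s u *
          br ((Polar r t * w) / (Polar r t * Polar s u))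
        = Polar r t * (Polar s u * br (w / Polar s u)))%polar.
now rewrite pdiv_pmul_cancel, pmul_assoc.
Qed.

Theorem theorem9p4 (br : polar -> polar) (hbr : one_plus_form br)
  (p : R) (hp : p <> 0)
  (a x0 x1 a0 a1 : polar)
  (hdef : Cplus (pval (a0 ^ p)%polar) (pval (a1 ^ p)%polar) <> RtoC 0) :
  proj (Hp br p ((a0 * a * x0)%polar, a0) ((a1 * a * x1)%polar, a1))
  = (a * proj (Hp br p ((a0 * x0)%polar, a0) ((a1 * x1)%polar, a1)))%polar.
Proof.
unfold proj, Hp, pdiv; cbn [fst snd].
rewrite (pmul_comm a0 a), (pmul_comm a1 a), <- !(pmul_assoc a).
rewrite !(ppow_mul a), pmul_psum, ppow_mul, ppow_inv by exact hp.
symmetry; apply pmul_assoc.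
Qed.
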